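(* Let $G$ be a group. There exist $n\ge1$ and $w\in\mathbb{Q}^n\cap(0,1]^n$ such that $\operatorname{Aut}(K_w)\cong G$ if and only if $G$ is isomorphic to the direct product of finitely many symmetric groups.
   Context: For $w\in\mathbb{Q}^n\cap(0,1]^n$ and $S\subseteq\{1,\dots,n\}$ put $w(S)=\sum_{i\in S}w_i$. $K_w$ is the abstract simplicial complex with vertex set $\{1,\dots,n\}$ in which $S$ is a face iff $w(S)\le 1$. $\operatorname{Aut}(K_w)\le S_n$ is the group of permutations $\sigma$ of $\{1,\dots,n\}$ with $S\in K_w\iff\sigma(S)\in K_w$ for all $S$. ''Symmetric groups'' means the groups $S_r$ of permutations of a finite set with $r\ge1$ elements. *)

(* Defs.v *)
From HB Require Import structures.
From mathcomp Require Import all_boot all_order all_algebra all_fingroup.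

Set Implicit Arguments.
Unset Strict Implicit.
Unset Printing Implicit Defensive.

Import Order.TTheory GRing.Theory Num.Theory.
Local Open Scope ring_scope.

Definition group_isomorphic (G H : groupType) : Prop :=
  exists f : {multiplicative G -> H}, bijective f.

(* Faces include the empty set; every element of [T] is a vertex. *)
Definition simplicial_complex (T : finType) (K : {set {set T}}) : Prop :=
  [/\ set0 \in K, forall x : T, [set x] \in K
    & forall A B : {set T}, A \subset B -> B \in K -> A \in K].

Definition complex_aut (T : finType) (K : {set {set T}}) : {set {perm T}} :=
  [set s : {perm T} | [forall S : {set T}, (S \in K) == (s @: S \in K)]].

Lemma complex_autP (T : finType) (K : {set {set T}}) (s : {perm T}) :
  reflect (forall S : {set T}, (S \in K) <-> (s @: S \in K))
          (s \in complex_aut K).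
Proof.
rewrite inE; apply: (iffP forallP) => H S.
  by rewrite (eqP (H S)).
by have [Hl Hr] := H S; apply/eqP; apply/idP/idP.
Qed.

Lemma complex_aut_group_set (T : finType) (K : {set {set T}}) :
  group_set (complex_aut K).
Proof.
apply/group_setP; split=> [|s t /complex_autP Hs /complex_autP Ht].
  apply/complex_autP => S.
  suff -> : [set (1%g : {perm T}) x | x in S] = S by [].
  by rewrite (eq_imset _ (@perm1 T)) imset_id.
apply/complex_autP => S; rewrite (eq_imset _ (permM s t)) imset_comp.
exact: iff_trans (Hs S) (Ht _).
Qed.

Canonical complex_aut_group (T : finType) (K : {set {set T}}) :
  {group {perm T}} := Group (complex_aut_group_set K).

Definition weight (n : nat) (w : 'rV[rat]_n) (S : {set 'I_n}) : rat :=
  \sum_(i in S) w 0 i.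

Definition threshold_complex (n : nat) (w : 'rV[rat]_n) : {set {set 'I_n}} :=
  [set S : {set 'I_n} | weight w S <= 1].

Lemma threshold_complexP (n : nat) (w : 'rV[rat]_n) :
  (forall i, 0 < w 0 i <= 1) -> simplicial_complex (threshold_complex w).
Proof.
move=> w01; split=> [|i|A B sAB]; rewrite !inE /weight.
- by rewrite big_set0.
- by rewrite big_set1; case/andP: (w01 i).
apply: le_trans; rewrite [leRHS](big_setID A) /= (setIidPr sAB) lerDl.
by apply: sumr_ge0 => i _; case/andP: (w01 i) => /ltW.
Qed.

(* Main.v *)
(* Call vertices x, y twins if the transposition (x y) is an automorphism.
   For a threshold complex every automorphism s sends x to a twin of x: x and
   s x lie in equally many faces, while exchanging x with a heavier y injects
   the faces through y into those through x.  Hence the automorphism group is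
   the group of permutations preserving the twin classes, a product of
   symmetric groups.  Conversely, blocks of prescribed sizes r > 1, one of
   weight j / (m + 2) for each j in 2..m+1, together with a single vertex of
   weight 1 / (m + 2), have no twins across blocks: if x is in a lighter block
   than y, some z of weight 1 - w(x) forms a face with x but not with y. *)

Require Import Defs.
From HB Require Import structures.
From mathcomp Require Import all_boot all_order all_algebra all_fingroup.

Set Implicit Arguments.
Unset Strict Implicit.
Unset Printing Implicit Defensive.

Import Order.TTheory GRing.Theory Num.Theory.
Local Open Scope ring_scope.

(** * Group isomorphisms, and groups of block-preserving permutations *)

Lemma morph_group_isomorphic (G H : groupType) (f : G -> H) :
  {morph f : x y / (x * y)%g} -> bijective f -> group_isomorphic G H.
Proof.
move=> fM bijf.
by exists (HB.pack_for {multiplicative G -> H} f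
             (isMultiplicative.Build _ _ f fM)).
Qed.

Lemma group_isomorphic_sym (G H : groupType) :
  group_isomorphic G H -> group_isomorphic H G.
Proof.
case=> f [g fK gK]; apply: (@morph_group_isomorphic _ _ g); last by exists f.
by move=> x y; apply: (can_inj fK); rewrite gmulfM !gK.
Qed.

Lemma group_isomorphic_trans (G H K : groupType) :
  group_isomorphic G H -> group_isomorphic H K -> group_isomorphic G K.
Proof.
case=> f bijf [g bijg].
apply: (@morph_group_isomorphic _ _ (g \o f)); last exact: bij_comp.
by move=> x y /=; rewrite !gmulfM.
Qed.

(** Through [psi] and [phi], [H] is the group of permutations of a disjoint union that preserve each
    summand: [F1] glues a family of permutations, [G] restricts to the summands. *)
Lemma fiber_perm_isomorphic (I : finType) (r : I -> nat) (T : finType)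
    (psi : {i : I & 'I_(r i)} -> T) (phi : T -> {i : I & 'I_(r i)})
    (H : {group {perm T}}) :
    cancel psi phi -> cancel phi psi ->
    (forall s : {perm T},
       s \in H <-> forall t, tag (phi (s (psi t))) = tag t) ->
  group_isomorphic [subg H] {dffun forall i : I, 'S_(r i)}.
Proof.
move=> psiK phiK HP; apply: group_isomorphic_sym.
pose tot (g : {dffun forall i : I, 'S_(r i)}) (t : {i : I & 'I_(r i)}) :=
  Tagged (fun i => 'I_(r i)) (g (tag t) (tagged t)).
have tot_inj g : injective (tot g).
  move=> [i x] [j y] /= e; have eij : i = j by exact: (congr1 tag e).
  by subst j; have /perm_inj/= -> := eq_from_Tagged e.
pose F0 g := psi \o tot g \o phi.
have F0_inj g : injective (F0 g).
  by apply: inj_comp (inj_comp _ (tot_inj g)) _; apply: can_inj; eassumption.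
pose F1 g : {perm T} := perm (F0_inj g).
have F1E g t : F1 g (psi t) = psi (tot g t) by rewrite permE /F0 /= psiK.
have F1H g : F1 g \in H by apply/HP => t; rewrite F1E psiK.
have F1M g h : F1 (g * h)%g = (F1 g * F1 h)%g.
  apply/permP => t; rewrite -(phiK t) permM !F1E /tot /=.
  by rewrite mulg_ffun permM.
pose into i (x : 'I_(r i)) : {i : I & 'I_(r i)} := Tagged _ x.
(* If [s] leaves block [i], [tagged_as] falls back on [x]; membership in [H] rules this out in
   [partE]. *)
pose part (s : {perm T}) i (x : 'I_(r i)) : 'I_(r i) :=
  tagged_as (into i x) (phi (s (psi (into i x)))).
have partE s i x : s \in H -> into i (part s i x) = phi (s (psi (into i x))).
  move=> /HP /(_ (into i x)); rewrite /part; case: (phi _) => j y /= eji.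
  by subst j; rewrite tagged_asE.
have part_inj (s : [subg H]) i : injective (part (sgval s) i).
  move=> x y /(congr1 (into i)); rewrite !partE ?subgP //.
  by move/(can_inj phiK)/perm_inj/(can_inj psiK) => e; apply: eq_from_Tagged e.
pose G (s : [subg H]) : {dffun forall i : I, 'S_(r i)} :=
  [ffun i => perm (part_inj s i)].
apply: (@morph_group_isomorphic _ _ (fun g => subg H (F1 g))).
  by move=> g h; rewrite F1M subgM.
exists G => [g | s].
  apply/ffunP => i; apply/permP => x; rewrite ffunE permE /part subgK //.
  by rewrite F1E psiK tagged_asE.
apply: val_inj; rewrite /= subgK //; apply/permP => t.
rewrite -(phiK t) F1E /tot ffunE permE.
by case: (phi t) => i x; rewrite -/(into _ _) partE ?subgP ?phiK.
Qed.

(** * Permutation groups determined by their transpositions *)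

Section TranspositionClosed.

Variables (T : finType) (H : {group {perm T}}).

(** Conjugating [tperm x y] by [tperm y z] gives [tperm x z] when [x] differs from [y] and [z]. *)
Lemma tperm_group_trans x y z :
  tperm x y \in H -> tperm y z \in H -> tperm x z \in H.
Proof.
move=> Hxy Hyz; have [<- | nxy] := eqVneq y x; first by [].
have [<- | nxz] := eqVneq z x; first by rewrite tperm1 group1.
by rewrite -{1}(tpermD nxy nxz) -{2}(tpermL y z) -tpermJ groupJ.
Qed.

(** Induction on the number of moved points: multiplying [s] by [tperm x (s x)] fixes [x] and moves
    no new point. *)
Lemma tperm_closed_mem (s : {perm T}) :
  (forall x, tperm x (s x) \in H) -> s \in H.
Proof.
have [m] := ubnP #|[set x | s x != x]|; elim: m s => // m IHm s ltm Hs.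
have [x sx | s1] := pickP (fun x => s x != x); last first.
  suff -> : s = 1%g by apply: group1.
  by apply/permP=> x; rewrite perm1; apply/eqP/negbFE/s1.
rewrite -(groupMr _ (Hs x)); apply: IHm.
  apply: leq_trans (proper_card _) (ltm : (_ <= m)%N).
  apply/properP; split; last by exists x; rewrite !inE ?permM ?tpermR ?eqxx.
  apply/subsetP=> z; rewrite !inE permM; apply: contra => /eqP sz.
  have nxz : x != z by apply: contraNneq sx => ->; rewrite sz.
  by rewrite sz tpermD // -[X in _ != X]sz (inj_eq perm_inj).
(* Apart from [x], only the point that [s] sends to [x] changes image, to [s x]; transitivity covers
   it. *)
move=> z; rewrite permM; case: tpermP => [szx | /perm_inj-> | _ _] //.
  by apply: tperm_group_trans (Hs x); rewrite -[X in tperm _ X]szx.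
by rewrite tperm1 group1.
Qed.

Hypothesis Htperm : forall s x, s \in H -> tperm x (s x) \in H.

(** The blocks are the classes of the equivalence [tperm x y \in H]. Elements of [H] preserve them
    by [Htperm]; permutations preserving them lie in [H] by [tperm_closed_mem]. *)
Lemma tperm_closed_isomorphic :
  exists (k : nat) (r : 'I_k -> nat),
    (forall j, (1 <= r j)%N) /\
    group_isomorphic [subg H] {dffun forall j : 'I_k, 'S_(r j)}.
Proof.
pose C x := [set y | tperm x y \in H].
have Cxx x : x \in C x by rewrite inE tperm1 group1.
have CP x y : reflect (C x = C y) (tperm x y \in H).
  apply: (iffP idP) => [Hxy | Cxy]; last by have:= Cxx y; rewrite -Cxy inE.
  apply/setP => z; rewrite !inE; apply/idP/idP; apply: tperm_group_trans => //.
  by rewrite tpermC.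
pose E := [set C x | x : T].
have CE x : C x \in E by apply: imset_f.
pose r (j : 'I_#|E|) := #|(enum_val j : {set T})|.
pose psi (t : {j & 'I_(r j)}) : T := enum_val (tagged t).
have psiE t : C (psi t) = enum_val (tag t).
  case: t => j i; rewrite /psi /=; move: (enum_val i) (enum_valP i) => y.
  have /imsetP[x _ ->] := enum_valP j.
  by rewrite inE => /CP ->.
have /fin_all_exists[phi phiK] : forall x, exists t, psi t = x.
  move=> x; pose j := enum_rank_in (CE x) (C x).
  have xj : x \in (enum_val j : {set T}) by rewrite enum_rankK_in.
  exists (existT (fun j => 'I_(r j)) j (enum_rank_in xj x)).
  exact: enum_rankK_in.
have psi_inj : injective psi.
  move=> t u e; have : tag t = tag u by apply: enum_val_inj; rewrite -!psiE e.
  case: t u e => [i x] [j y] /= e eij; subst j.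
  by move/enum_val_inj: e => /= ->.
exists #|E|, r; split=> [j |].
  rewrite card_gt0; have /imsetP[x _ ->] := enum_valP j.
  by apply/set0Pn; exists x.
apply: (@fiber_perm_isomorphic _ _ _ psi phi) => //.
  by move=> t; apply: psi_inj; rewrite phiK.
have tagE x y : tag (phi x) = tag (phi y) <-> tperm x y \in H.
  split=> [e | /CP e]; first by apply/CP; rewrite -(phiK x) -(phiK y) !psiE e.
  by apply: enum_val_inj; rewrite -!psiE !phiK.
move=> s; split=> [Hs t | Hs].
  have {2}<- : phi (psi t) = t by apply: psi_inj; rewrite phiK.
  by apply/tagE; rewrite tpermC Htperm.
by apply: tperm_closed_mem => x; apply/tagE; rewrite -(Hs (phi x)) phiK.
Qed.

End TranspositionClosed.

(** * Twins in threshold complexes *)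

Lemma imset_tperm_id (T : finType) (x y : T) (A : {set T}) :
  (x \in A) = (y \in A) -> tperm x y @: A = A.
Proof.
move=> exy; apply/eqP; rewrite eqEcard card_imset ?leqnn ?andbT; last first.
  exact: perm_inj.
apply/subsetP => _ /imsetP[z Az ->].
by case: tpermP => [zx | zy | //]; [rewrite -exy -zx | rewrite exy -zy].
Qed.

Lemma imset_tpermK (T : finType) (x y : T) :
  involutive (fun A : {set T} => tperm x y @: A).
Proof.
move=> A; rewrite -imset_comp -[RHS]imset_id.
by apply: eq_imset => z /=; rewrite tpermK.
Qed.

Section ThresholdComplex.

Variables (n : nat) (w : 'rV[rat]_n).
Implicit Types (x y : 'I_n) (S : {set 'I_n}) (s : {perm 'I_n}).

Let K := threshold_complex w.
Let faces_at x := [set S in K | x \in S].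

Lemma weight_imset s S : weight w (s @: S) = \sum_(i in S) w 0 (s i).
Proof. by rewrite /weight big_imset //= => i j _ _; apply: perm_inj. Qed.

(** Either [S] contains both points and is fixed, or the swap replaces [y] by the lighter [x]. *)
Lemma faces_at_tperm x y S :
  w 0 x <= w 0 y -> S \in faces_at y -> tperm x y @: S \in faces_at x.
Proof.
move=> lexy; rewrite !inE => /andP[KS yS].
have -> : x \in tperm x y @: S by apply/imsetP; exists y; rewrite ?tpermR.
rewrite andbT.
have [xS | xS] := boolP (x \in S); first by rewrite imset_tperm_id ?xS ?yS.
apply: le_trans KS; rewrite weight_imset; apply: ler_sum => i iS.
by case: tpermP => [ix | -> |] //; rewrite ix (negPf xS) in iS.
Qed.

Lemma card_faces_at s x :
  s \in complex_aut K -> #|faces_at (s x)| = #|faces_at x|.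
Proof.
move=> /complex_autP Ks.
rewrite -[RHS](card_imset _ (imset_inj (@perm_inj _ s))).
apply: eq_card => S; apply/idP/imsetP => [|[R]]; last first.
  by rewrite inE => /andP[/Ks KR xR ->]; rewrite inE KR imset_f.
rewrite inE => /andP[KS xS].
have eS : S = s @: (s^-1%g @: S).
  rewrite -imset_comp -[LHS]imset_id; apply: eq_imset => z /=.
  by rewrite permKV.
exists (s^-1%g @: S) => //; rewrite inE; apply/andP; split.
  by apply/Ks; rewrite -eS.
by apply/imsetP; exists (s x) => //; rewrite permK.
Qed.

(* Swapping [x] for the heavier [y] injects the faces through [y] into those
   through [x]; equal cardinals make this injection a bijection. *)
Lemma tperm_aut x y :
  #|faces_at x| = #|faces_at y| -> tperm x y \in complex_aut K.
Proof.
wlog lexy : x y / w 0 x <= w 0 y => [IH exy | exy].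
  by have [/IH -> | /ltW/IH H] := leP (w 0 x) (w 0 y); rewrite // tpermC H.
pose t S := tperm x y @: S.
have tK : involutive t by apply: imset_tpermK.
have tyx S : S \in faces_at y -> t S \in faces_at x by apply: faces_at_tperm.
have txy S : S \in faces_at x -> t S \in faces_at y.
  have -> : faces_at x = t @: faces_at y.
    apply/esym/eqP; rewrite eqEcard card_imset ?exy ?leqnn ?andbT.
      by apply/subsetP => _ /imsetP[R yR ->]; apply: tyx.
    exact: can_inj tK.
  by case/imsetP => R yR ->; rewrite tK.
have facesE z S : (S \in faces_at z) = (S \in K) && (z \in S).
  by rewrite in_set.
have tKS S : S \in K -> t S \in K.
  move=> KS; have [xS | xS] := boolP (x \in S).
    by have := txy S; rewrite !facesE KS xS => /(_ isT)/andP[].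
  have [yS | yS] := boolP (y \in S).
    by have := tyx S; rewrite !facesE KS yS => /(_ isT)/andP[].
  by rewrite /t imset_tperm_id ?(negPf xS) ?(negPf yS).
by apply/complex_autP => S; split=> [|/tKS]; [apply: tKS | rewrite tK].
Qed.

Lemma complex_aut_tperm s x :
  s \in complex_aut K -> tperm x (s x) \in complex_aut K.
Proof. by move=> Ks; apply: tperm_aut; rewrite card_faces_at. Qed.

End ThresholdComplex.

(** * Realizing a product of symmetric groups *)

Section Realization.

Variables (k : nat) (r : 'I_k -> nat).
Let J := {j : 'I_k | (1 < r j)%N}.

(* The trivial factors are dropped, and [None] is one trivial factor added back
   so that there is at least one vertex. *)
Definition block_size (i : option J) : nat :=
  if i is Some j then r (val j) else 1.

Lemma perm_ord_le1 (m : nat) : (m <= 1)%N -> forall s t : 'S_m, s = t.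
Proof.
move=> m1 s t; apply/permP => x; apply: val_inj => /=.
by have:= leq_trans (ltn_ord (s x)) m1; have:= leq_trans (ltn_ord (t x)) m1;
   rewrite !ltnS !leqn0 => /eqP-> /eqP->.
Qed.

Lemma block_size_isomorphic :
  group_isomorphic {dffun forall i : option J, 'S_(block_size i)}
    {dffun forall j : 'I_k, 'S_(r j)}.
Proof.
apply: group_isomorphic_sym.
pose P := {dffun forall j : 'I_k, 'S_(r j)}.
pose Q := {dffun forall i : option J, 'S_(block_size i)}.
pose f (g : P) : Q :=
  [ffun i => match i return 'S_(block_size i) with
             | Some j => g (val j) | None => 1%g end].
(* Matching on [idP] yields the proof needed to index by [J]; the default [1%g] is forced, since
   ['S_(r j)] is trivial when [r j <= 1]. *)
pose f' (h : Q) : P :=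
  [ffun j => match @idP (1 < r j)%N with
             | ReflectT p => h (Some (exist _ j p)) | _ => 1%g end].
apply: (@morph_group_isomorphic _ _ f).
  by move=> g h; apply/ffunP => -[j|]; rewrite mulg_ffun !ffunE ?mulg1.
exists f' => [g | h]; apply/ffunP.
  move=> j; rewrite ffunE; case: {-}_ / idP => [p | /negP].
    by rewrite ffunE.
  by rewrite -leqNgt => p; apply: perm_ord_le1.
case=> [[j p]|]; last exact: perm_ord_le1.
rewrite !ffunE /=; case: {-}_ / idP => // p'.
by rewrite (bool_irrelevance p p').
Qed.

Let V := {i : option J & 'I_(block_size i)}.
Let m := #|{: J}|.

Definition block_level (i : option J) : nat :=
  if i is Some j then (enum_rank j).+1 else 0.

Let level (x : 'I_#|{: V}|) := block_level (tag (enum_val x)).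

(** The shifts are chosen so that two distinct vertices span an edge exactly when their levels add
    up to at most [m]. *)
Definition block_weight : 'rV[rat]_#|{: V}| :=
  \row_x ((level x).+1%:R / m.+2%:R).

Lemma block_level_inj : injective block_level.
Proof. by case=> [i|] [j|] //= [/ord_inj/enum_rank_inj->]. Qed.

Lemma block_level_le i : (block_level i <= m)%N.
Proof. by case: i => [j|] //=; apply: ltn_ord. Qed.

Lemma block_weight_bounds x : 0 < block_weight 0 x <= 1.
Proof.
rewrite mxE divr_gt0 ?ltr0n //= ler_pdivrMr ?ltr0n // mul1r ler_nat.
by rewrite ltnS leqW // block_level_le.
Qed.

Lemma block_pair_face x y : x != y ->
  ([set x; y] \in threshold_complex block_weight) =
  (level x + level y <= m)%N.
Proof.
move=> nxy; rewrite inE /weight big_setU1 ?inE //= big_set1 !mxE -mulrDl.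
by rewrite ler_pdivrMr ?ltr0n // mul1r -natrD ler_nat addSn addnS !ltnS.
Qed.

(* The pairs [x], [z] with levels adding up to [m] are faces, and raising the
   level of [x] destroys them. Only the level 0, never complementary to a level
   below [m], has a single vertex. *)
Lemma block_tperm_tag x y :
  tperm x y \in complex_aut (threshold_complex block_weight) ->
  tag (enum_val x) = tag (enum_val y).
Proof.
move=> Kxy; apply: block_level_inj.
rewrite -/(level x) -/(level y).
wlog ltxy : x y Kxy / (level x < level y)%N.
  move=> IH; case: (ltngtP (level x) (level y)) => // [|]; first exact: IH.
  by rewrite tpermC in Kxy; move/IH => ->.
set a := level x in ltxy *; set b := level y in ltxy *.
have leb : (b <= m)%N by apply: block_level_le.
(* As [a < b <= m], level [m - a] is positive, so it belongs to a block [Some j], with [j] of rank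
   [m - a.+1]; that block has at least two vertices. *)
have ltm : (m - a.+1 < m)%N.
  by rewrite ltn_subrL (leq_trans _ leb) // (leq_ltn_trans _ ltxy).
pose j : J := enum_val (Ordinal ltm).
have lvl : block_level (Some j) = (m - a)%N.
  by rewrite /= enum_valK /= subnSK // (leq_trans ltxy).
have avoid u : exists2 z, level z = (m - a)%N & z != u.
  pose v0 := existT (fun i => 'I_(block_size i)) (Some j)
                    (Ordinal (ltnW (valP j))).
  pose v1 := existT (fun i => 'I_(block_size i)) (Some j) (Ordinal (valP j)).
  have n01 : enum_rank v0 != enum_rank v1.
    by rewrite (inj_eq enum_rank_inj) eq_Tagged.
  have [e | ?] := eqVneq (enum_rank v0) u; last first.
    by exists (enum_rank v0); rewrite ?/level ?enum_rankK.
  by exists (enum_rank v1); rewrite ?/level ?enum_rankK // -e eq_sym.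
(* [avoid] excludes one vertex only; the level of [z] excludes the other: [y] if [a = m - a],
   because [a < b], and [x] otherwise. *)
have [z [zl zx zy]] : exists z, [/\ level z = (m - a)%N, z != x & z != y].
  have [ea | na] := eqVneq a (m - a)%N.
    have [z zl zx] := avoid x; exists z; split=> //.
    by apply: contraTneq ltxy => ezy; rewrite /b -ezy zl -ea ltnn.
  have [z zl zy] := avoid y; exists z; split=> //.
  by apply: contraNneq na => ezx; rewrite -zl ezx.
have/complex_autP/(_ [set x; z]) := Kxy.
rewrite imsetU1 imset_set1 tpermL tpermD 1?eq_sym //.
rewrite !block_pair_face 1?eq_sym // zl -/a -/b.
have lea : (a <= m)%N by apply: leq_trans (ltnW ltxy) leb.
rewrite subnKC // leqnn => -[/(_ isT)].
by rewrite -{2}(subnKC lea) leq_add2r leqNgt ltxy.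
Qed.

(** Automorphisms move vertices to twins, which share a block; conversely, weights are constant on
    blocks, so preserving blocks preserves the weight of every set. *)
Lemma block_complex_aut (s : {perm 'I_#|{: V}|}) :
  s \in complex_aut (threshold_complex block_weight) <->
  forall v, tag (enum_val (s (enum_rank v))) = tag v.
Proof.
split=> [Ks v | s_tag].
  rewrite -{2}(enum_rankK v); apply/esym/block_tperm_tag.
  exact: complex_aut_tperm.
apply/complex_autP => S; rewrite !inE weight_imset.
suff -> : \sum_(i in S) block_weight 0 (s i) = weight block_weight S by [].
by apply: eq_bigr => i _; rewrite !mxE /level -{1}(enum_valK i) s_tag.
Qed.

End Realization.

Theorem theorem1p3 (G : groupType) :
  (exists (n : nat) (w : 'rV[rat]_n),
     [/\ (1 <= n)%N,
         forall i : 'I_n, 0 < w 0 i <= 1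
       & group_isomorphic [subg complex_aut (threshold_complex w)] G])
  <->
  (exists (k : nat) (r : 'I_k -> nat),
     (forall j : 'I_k, (1 <= r j)%N) /\
     group_isomorphic G {dffun forall j : 'I_k, 'S_(r j)}).
Proof.
split=> [[n [w [_ _ isoG]]] | [k [r [r_gt0 isoG]]]].
  have [k [r [r_gt0 isoP]]] := tperm_closed_isomorphic (@complex_aut_tperm _ w).
  exists k, r; split=> //; apply: group_isomorphic_trans isoP.
  exact: group_isomorphic_sym.
exists _, (block_weight r); split; last 1 first.
- apply: group_isomorphic_trans (group_isomorphic_sym isoG).
  apply: group_isomorphic_trans (block_size_isomorphic r).
  exact: fiber_perm_isomorphic (@enum_rankK _) (@enum_valK _)
           (@block_complex_aut _ r).
- by apply/card_gt0P; exists (existT (fun i => 'I_(block_size i)) None ord0).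
- exact: block_weight_bounds.
Qed.
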